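(* Let $p>q$ be positive integers, let $\beta>0$, and let $\triangle n\ge3$ be an integer. Set $$R(\gamma)=\beta\left[(\triangle n)^{2p}s_{2p+1}(\gamma)-1\right]-\left[(\triangle n)^{2q}s_{2q+1}(\gamma)-1\right],$$ $$\beta_0(\triangle n)=\frac{(\triangle n)^{2q}-1}{(\triangle n)^{2p}-1},\qquad \beta_{-1/4}(\triangle n)=\frac{(\triangle n/2)^{2q}-1}{(\triangle n/2)^{2p}-1},$$ where $s_0=2$, $s_1=1$, $s_{m+1}(\gamma)=s_m(\gamma)+\gamma s_{m-1}(\gamma)$ for $m\ge1$. For the linearized problem $v_t=cv_x+Av_{(2q+1)x}+Bv_{(2p+1)x}$ at zero amplitude with $c=c_1=\beta-1$, where $A(-1)^q=1$ and $-B(-1)^p=\beta$, the presence and character of collisions of eigenvalues whose Fourier indices differ by $\triangle n$ are as follows. (i) If $\beta<\beta_0(\triangle n)$, then there is a collision of eigenvalues of the same signature, i.e., there is a root $\gamma>0$ of $R(\gamma)=0$, and there is no root $\gamma\in[-1/4,0)$. (ii) If $\beta_0(\triangle n)<\beta\le\beta_{-1/4}(\triangle n)$, then there is a collision of eigenvalues of opposite signature, i.e., there is a root $\gamma\in[-1/4,0)$ of $R(\gamma)=0$. (iii) If $\beta_{-1/4}(\triangle n)<\beta$, then there is no collision of eigenvalues, i.e., all real roots $\gamma$ of $R(\gamma)=0$ satisfy $\gamma<-1/4$.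
   Context: The linearized problem arises from $u_t=\partial_xf(u)+A\,\partial_x^{2q+1}u+B\,\partial_x^{2p+1}u$ with $2\pi$-periodic boundary conditions, in a frame moving with velocity $c$; $v_{(m)x}$ denotes $\partial_x^mv$. Its dispersion relation, with $\alpha=A(-1)^q$ normalized to $1$ and $\beta=-B(-1)^p$, is $\Omega(k)=-ck-k^{2q+1}+\beta k^{2p+1}$. The value $c=c_1=\beta-1$ is chosen so that $\Omega(1)=0$. The eigenvalues are $\lambda_n^{(\tilde\mu)}=-i\Omega(n+\tilde\mu)$, $n\in\mathbb{Z}$, $\tilde\mu\in(-1/2,1/2]$. With $\mu=n_2+\tilde\mu$ and $\triangle n=n_1-n_2>0$, the collision condition $\lambda_{n_1}^{(\tilde\mu)}=\lambda_{n_2}^{(\tilde\mu)}$ is $\Omega(\mu+\triangle n)=\Omega(\mu)$, and $\Omega(\mu+\triangle n)-\Omega(\mu)=\triangle n\,R(\gamma)$ with $\gamma=\mu(\mu+\triangle n)/(\triangle n)^2$. The Krein signature of a nonzero $\lambda_n^{(\tilde\mu)}$ is $-\operatorname{sign}\left(\Omega(n+\tilde\mu)/(n+\tilde\mu)\right)$. Convention: ''collision of eigenvalues of opposite (same) signature'' with index difference $\triangle n$ means that $R$ has a real root $\gamma\in[-1/4,0)$ (respectively $\gamma>0$); real $\mu$ corresponds to real $\gamma\ge-1/4$. The precise content of each item is the statement after ''i.e.''. *)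

(* Defs.v *)
From mathcomp Require Import all_boot all_order all_algebra.
From mathcomp Require Import ring.
From mathcomp Require Import reals.
Set Implicit Arguments.
Unset Strict Implicit.
Unset Printing Implicit Defensive.
Import Order.TTheory GRing.Theory Num.Theory.
Local Open Scope ring_scope.

Fixpoint sseq (K : realType) (g : K) (m : nat) : K :=
  match m with
  | 0 => 2
  | 1 => 1
  | (m''.+1 as m').+1 => sseq g m' + g * sseq g m''
  end.

(* A mode exp(i k x + lambda t) of
     v_t = c v_x + A d_x^(2q+1) v + B d_x^(2p+1) v
   has lambda = - i * Omega k. *)
Definition Omega (K : realType) (p q : nat) (A B c k : K) : K :=
  - c * k - A * (-1) ^+ q * k ^+ (2 * q + 1)
          - B * (-1) ^+ p * k ^+ (2 * p + 1).

Definition Rfun (K : realType) (p q : nat) (beta : K) (dn : nat) (g : K) : K :=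
  beta * (dn%:R ^+ (2 * p) * sseq g (2 * p + 1) - 1)
  - (dn%:R ^+ (2 * q) * sseq g (2 * q + 1) - 1).

Definition beta0 (K : realType) (p q dn : nat) : K :=
  (dn%:R ^+ (2 * q) - 1) / (dn%:R ^+ (2 * p) - 1).

(* beta_{-1/4} *)
Definition betaN14 (K : realType) (p q dn : nat) : K :=
  ((dn%:R / 2) ^+ (2 * q) - 1) / ((dn%:R / 2) ^+ (2 * p) - 1).

(* The eigenvalues - i * Omega (mu + dn) and - i * Omega mu, mu real, coincide
   iff R vanishes at g = mu * (mu + dn) / dn ^ 2 (see [Omega_diff]); real mu
   correspond to g >= -1/4.  The Krein signature of the mode k is
   - sgn (Omega k / k), so at a nonzero common eigenvalue the two signatures
   are opposite when g < 0 and equal when g > 0. *)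
Definition opposite_signature_collision (K : realType) (R : K -> K) : Prop :=
  exists g : K, [/\ - (1 / 4) <= g, g < 0 & R g = 0].

Definition same_signature_collision (K : realType) (R : K -> K) : Prop :=
  exists g : K, 0 < g /\ R g = 0.

Lemma Omega_diff (K : realType) (p q dn : nat) (A B beta c mu : K) :
    (0 < dn)%N -> A * (-1) ^+ q = 1 -> - B * (-1) ^+ p = beta ->
    c = beta - 1 ->
  Omega p q A B c (mu + dn%:R) - Omega p q A B c mu
    = dn%:R * Rfun p q beta dn (mu * (mu + dn%:R) / dn%:R ^+ 2).
Proof.
move=> dn_gt0 hA hB ->; have D0 : dn%:R != 0 :> K by rewrite pnatr_eq0 -lt0n.
rewrite /Omega /Rfun hA mulNr in hB *.
have -> : B * (-1) ^+ p = - beta by rewrite -hB opprK.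
set D : K := dn%:R in D0 *; set g := mu * _ / _.
have P m : (mu + D) ^+ m + (- mu) ^+ m = D ^+ m * sseq g m.
  suff: (mu + D) ^+ m + (- mu) ^+ m = D ^+ m * sseq g m /\
        (mu + D) ^+ m.+1 + (- mu) ^+ m.+1 = D ^+ m.+1 * sseq g m.+1 by case.
  elim: m => [|m [IH1 IH2]]; first by rewrite /= !expr0 !expr1; split; ring.
  split=> //; rewrite [sseq _ _]/= -/(sseq g m.+1) mulrDr.
  have -> : D ^+ m.+2 * sseq g m.+1 = D * (D ^+ m.+1 * sseq g m.+1).
    by rewrite [D ^+ m.+2]exprS mulrA.
  have -> : D ^+ m.+2 * (g * sseq g m) = mu * (mu + D) * (D ^+ m * sseq g m).
    by rewrite /g !exprS; field.
  by rewrite -IH1 -IH2 !exprS; ring.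
have O m : (mu + D) ^+ (2 * m + 1) = mu ^+ (2 * m + 1)
                                     + D * (D ^+ (2 * m) * sseq g (2 * m + 1)).
  have := P (2 * m + 1)%N.
  have -> : (- mu) ^+ (2 * m + 1) = - mu ^+ (2 * m + 1).
    by rewrite exprNn addn1 exprS exprM sqrrN expr1n expr1n; ring.
  by move/(canRL (subrK _)) => ->; rewrite [D ^+ (_ + 1)]exprD; ring.
by rewrite !O; ring.
Qed.

(* Main.v *)
Require Import Defs.
From mathcomp Require Import all_boot all_order all_algebra.
From mathcomp Require Import ring lra zify.
From mathcomp Require Import reals.
Set Implicit Arguments.
Unset Strict Implicit.
Unset Printing Implicit Defensive.
Import Order.TTheory GRing.Theory Num.Theory.
Local Open Scope ring_scope.

(** Write R = beta * S_p - S_q with S_m = dn^(2m) s_{2m+1} - 1.  For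
    g >= -1/4 put u = sqrt (1 + 4 g) and E = (dn / 2)^2 > 1; then
    S_m = E^m * (sum over even i of 'C(2m+1, i) u^i) - 1.  The quotients of the
    coefficients of S_q by those of S_p decrease with the degree, so S_q / S_p
    decreases in g.  Its values at 0 and -1/4 are beta0 and beta_{-1/4}, and
    roots of R are the points where it equals beta. *)

(** * Inequalities for binomial coefficients and powers *)

(** Passing from [j] to [j + 1] multiplies C(n, j) by (n - j) / (j + 1), a factor that grows with
    [n]. *)
Lemma leq_mul_bin (n m i j : nat) : (n <= m)%N -> (i <= j)%N ->
  ('C(n, j) * 'C(m, i) <= 'C(n, i) * 'C(m, j))%N.
Proof.
move=> le_nm; elim: j => [|j IH]; first by rewrite leqn0 => /eqP ->.
rewrite leq_eqVlt => /predU1P[-> //|]; rewrite ltnS => /IH {}IH.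
rewrite -(leq_pmul2l (ltn0Sn j)) mulnA mul_bin_left [leqRHS]mulnCA.
by rewrite mul_bin_left -mulnA [leqRHS]mulnCA leq_mul // leq_sub2r.
Qed.

(** The case [i = 2] of [leq_mul_bin], where C(2m+1, 2) = m (2m+1); the factors 2q+1 <= 2p+1 are
    then dropped. It serves the comparison with degree 0, where the coefficient is E^m - 1 instead
    of E^m. *)
Lemma leq_mul_bin_odd (q p j : nat) : (q <= p)%N -> (2 <= j)%N ->
  (p * 'C(2 * q + 1, j) <= q * 'C(2 * p + 1, j))%N.
Proof.
move=> le_qp j_ge2; have [->|q_gt0] := posnP q.
  by rewrite bin_small ?muln0.
have H := @leq_mul_bin (2 * q + 1) (2 * p + 1) 2 j ltac:(lia) j_ge2.
have bin2E m : 'C(2 * m + 1, 2) = (m * (2 * m + 1))%N.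
  by rewrite bin2 addn1 /= mulnCA [X in X./2]mul2n doubleK mulnC.
rewrite !bin2E in H.
rewrite -(@leq_pmul2l (2 * p + 1)); last by rewrite addn1.
apply: leq_trans (_ : q * (2 * q + 1) * 'C(2 * p + 1, j) <= _)%N; last first.
  by rewrite -mulnA [leqRHS]mulnCA !leq_mul //; lia.
by rewrite [leqLHS]mulnCA mulnA [leqLHS]mulnC.
Qed.

Lemma bernoulli_ge (K : realType) (E : K) (n : nat) : 1 <= E ->
  n%:R * (E - 1) <= E ^+ n - 1.
Proof.
move=> E_ge1; elim: n => [|n IH]; first by rewrite expr0 mul0r subrr.
have := exprn_ege1 n E_ge1.
by rewrite exprS -natr1 mulrDl mul1r; nra.
Qed.

(* Concavity of [x |-> 1 - E ^- x], multiplied by [E ^+ (p + q)]. *)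
Lemma expr_sub1_concave (K : realType) (E : K) (q p : nat) :
  1 <= E -> (q <= p)%N ->
  q%:R * (E ^+ q * (E ^+ p - 1)) <= p%:R * (E ^+ p * (E ^+ q - 1)).
Proof.
move=> E_ge1; elim: p => [|p IH]; first by rewrite leqn0 => /eqP ->.
rewrite leq_eqVlt => /predU1P[-> //|]; rewrite ltnS => le_qp.
have {}IH := IH le_qp.
have E_ge0 : 0 <= E by apply: le_trans E_ge1.
have Hb := bernoulli_ge q E_ge1.
have Eqp : E ^+ q <= E ^+ p by rewrite ler_weXn2l.
have Ep1 := exprn_ege1 p E_ge1; have Eq1 := exprn_ege1 q E_ge1.
(* What remains to be shown once [E] times the induction hypothesis is subtracted. *)
have step : E ^+ q * (q%:R * (E - 1)) <= E ^+ p * (E * (E ^+ q - 1)).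
  apply: ler_pM => //; rewrite ?exprn_ge0 ?mulr_ge0 ?ler0n ?subr_ge0 //.
  by apply: le_trans Hb _; rewrite ler_peMl ?subr_ge0.
have := ler_wpM2l E_ge0 IH.
by rewrite exprS -natr1; lra.
Qed.

(** * Monotone quotients of polynomials *)

(** Symmetrization: twice the difference of the two sides is the double sum of the [F i j], whose
    two factors always have the same sign. *)
Lemma ler_cross_sum (K : realType) (N : nat) (a b : nat -> K) (x y : K) :
  (forall i j : nat, (i < j)%N -> a j * b i <= a i * b j) -> 0 <= x -> x <= y ->
  (\sum_(i < N) a i * y ^+ i) * (\sum_(i < N) b i * x ^+ i)
  <= (\sum_(i < N) a i * x ^+ i) * (\sum_(i < N) b i * y ^+ i).
Proof.
move=> ab x_ge0 le_xy; have y_ge0 := le_trans x_ge0 le_xy.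
have xy i j : (i <= j)%N -> x ^+ j * y ^+ i <= x ^+ i * y ^+ j.
  move=> /subnKC <-; rewrite !exprD mulrAC [leRHS]mulrA.
  by rewrite ler_wpM2l ?mulr_ge0 ?exprn_ge0 // lerXn2r.
pose F (i j : 'I_N) :=
  (a i * b j - a j * b i) * (x ^+ i * y ^+ j - x ^+ j * y ^+ i).
have F_ge0 i j : 0 <= F i j.
  rewrite /F; case: (ltngtP i j) => [ij|ji|->].
  - by rewrite mulr_ge0 ?subr_ge0 ?ab ?xy // ltnW.
  - by rewrite mulr_le0 ?subr_le0 ?ab ?xy // ltnW.
  - by rewrite !subrr mulr0.
rewrite -subr_ge0 -(@pmulrn_lge0 _ _ 2) //.
set L := (X in X *+ 2); suff -> : L *+ 2 = \sum_(i < N) \sum_(j < N) F i j.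
  by apply: sumr_ge0 => i _; apply: sumr_ge0 => j _.
(* [P] and [Q] expand a product with the indices in either order, so that the two copies of [L]
   yield the two halves of [F]. *)
have P (c d : nat -> K) : (\sum_(i < N) c i) * (\sum_(j < N) d j) =
    \sum_(i < N) \sum_(j < N) c i * d j by rewrite big_distrlr.
have Q (c d : nat -> K) : (\sum_(i < N) c i) * (\sum_(j < N) d j) =
    \sum_(i < N) \sum_(j < N) c j * d i by rewrite P exchange_big.
rewrite /L mulr2n {1}(P (fun i => a i * x ^+ i) (fun i => b i * y ^+ i)).
rewrite (Q (fun i => a i * x ^+ i) (fun i => b i * y ^+ i)).
rewrite {1}(P (fun i => a i * y ^+ i) (fun i => b i * x ^+ i)).
rewrite (Q (fun i => a i * y ^+ i) (fun i => b i * x ^+ i)).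
rewrite -!sumrB -big_split; apply: eq_bigr => i _.
rewrite -!sumrB -big_split; apply: eq_bigr => j _.
by rewrite /F /=; ring.
Qed.

(** * The sequence s_m *)

Lemma sseqSS (K : realType) (g : K) (m : nat) :
  sseq g m.+2 = sseq g m.+1 + g * sseq g m.
Proof. by []. Qed.

Lemma sseq0 (K : realType) (m : nat) : sseq (0 : K) m.+1 = 1.
Proof. by elim: m => // m IH; rewrite sseqSS IH mul0r addr0. Qed.

(** The numbers (1 + u) / 2 and (1 - u) / 2 are the roots of t^2 = t + g. *)
Lemma sseq_closed (K : realType) (g u : K) (m : nat) : u ^+ 2 = 1 + 4 * g ->
  2 ^+ m * sseq g m = (1 + u) ^+ m + (1 - u) ^+ m.
Proof.
move=> hu.
suff: 2 ^+ m * sseq g m = (1 + u) ^+ m + (1 - u) ^+ m /\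
      2 ^+ m.+1 * sseq g m.+1 = (1 + u) ^+ m.+1 + (1 - u) ^+ m.+1 by case.
elim: m => [|m [IH1 IH2]]; first by rewrite /= !expr0 !expr1; split; ring.
split=> //; rewrite sseqSS.
have -> : 2 ^+ m.+2 * (sseq g m.+1 + g * sseq g m) =
   2 * (2 ^+ m.+1 * sseq g m.+1) + (4 * g) * (2 ^+ m * sseq g m).
  by rewrite !exprS; ring.
rewrite IH1 IH2 (_ : 4 * g = u ^+ 2 - 1); last by rewrite hu; ring.
by rewrite !exprS; ring.
Qed.

Lemma sseq_ge1 (K : realType) (g : K) (m : nat) : 0 <= g -> 1 <= sseq g m.
Proof.
move=> g_ge0; suff [] : 1 <= sseq g m /\ 1 <= sseq g m.+1 by [].
elim: m => [|m [IH1 IH2]]; first by rewrite /= ler1n.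
by split=> //; rewrite sseqSS; nra.
Qed.

(** Used to fix the sign of R for large [g]. The recurrence gives the factor [g] once; the remaining
    steps only use that s_m does not decrease. *)
Lemma sseq_odd_growth (K : realType) (g : K) (q p : nat) :
  0 <= g -> (q < p)%N -> g * sseq g (2 * q + 1) <= sseq g (2 * p + 1).
Proof.
move=> g_ge0; elim: p => // p IH; have rec : sseq g (2 * p.+1 + 1) =
    sseq g (2 * p + 2) + g * sseq g (2 * p + 1).
  by rewrite (_ : 2 * p.+1 + 1 = (2 * p + 1).+2)%N ?sseqSS -?addnS //; lia.
have gs i : 0 <= g * sseq g i.
  by rewrite mulr_ge0 // (le_trans ler01) ?sseq_ge1.
have s_ge0 := le_trans ler01 (sseq_ge1 (2 * p + 2) g_ge0).
rewrite rec ltnS leq_eqVlt => /predU1P[->|/IH {}IH]; first by rewrite lerDr.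
have mono : sseq g (2 * p + 1) <= sseq g (2 * p + 2).
  by rewrite addn2 addn1 sseqSS lerDl.
by rewrite (le_trans IH) // (le_trans mono) // lerDl.
Qed.

Lemma sseq_horner (K : realType) (m : nat) :
  exists P : {poly K}, forall g, P.[g] = sseq g m.
Proof.
suff [] : (exists P : {poly K}, forall g, P.[g] = sseq g m) /\
      (exists P : {poly K}, forall g, P.[g] = sseq g m.+1) by [].
elim: m => [|m [[P hP] [Q hQ]]].
  by split; [exists 2%:P|exists 1%:P] => g; rewrite hornerC.
split; first by exists Q.
by exists (Q + 'X * P) => g; rewrite sseqSS !hornerE hP hQ.
Qed.

(** * The functions S_m and their expansion in u *)

Definition mode_fun (K : realType) (dn m : nat) (g : K) : K :=
  dn%:R ^+ (2 * m) * sseq g (2 * m + 1) - 1.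

(** Coefficient of u^i in S_m: odd powers cancel in (1 + u)^(2m+1) + (1 - u)^(2m+1), and the -1
    enters in degree 0. *)
Definition mode_coef (K : realType) (dn m i : nat) : K :=
  (dn%:R / 2) ^+ (2 * m) * (~~ odd i * 'C(2 * m + 1, i))%:R - (i == 0)%:R.

(** The bound [N] is left free so that S_q and S_p can be summed over the same range. *)
Lemma mode_fun_sum (K : realType) (dn m N : nat) (g u : K) :
  (2 * m + 1 < N)%N -> u ^+ 2 = 1 + 4 * g ->
  mode_fun dn m g = \sum_(i < N) mode_coef K dn m i * u ^+ i.
Proof.
move=> mN hu; have N_gt0 : (0 < N)%N by apply: leq_trans mN.
have binE (w : K) : (1 + w) ^+ (2 * m + 1) =
    \sum_(i < N) 'C(2 * m + 1, i)%:R * w ^+ i.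
  pose F i := 1 ^+ (2 * m + 1 - i) * w ^+ i *+ 'C(2 * m + 1, i).
  rewrite exprDn (big_ord_widen _ F mN) /F.
  rewrite big_mkcond /=; apply: eq_bigr => i _; rewrite ltnS expr1n mul1r.
  by case: leqP => h; rewrite ?mulr_natl // bin_small ?mul0r.
have -> : mode_fun dn m g = (dn%:R / 2) ^+ (2 * m)
    * ((1 + u) ^+ (2 * m + 1) + (1 - u) ^+ (2 * m + 1)) / 2 - 1.
  rewrite -(sseq_closed _ hu) /mode_fun expr_div_n exprD expr1; field.
  by rewrite expf_neq0 // pnatr_eq0.
have oneE : 1 = \sum_(i < N) ((i == 0 :> nat)%:R * u ^+ i) :> K.
  rewrite (bigD1 (Ordinal N_gt0)) //= expr0 mulr1 big1 ?addr0 // => i.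
  by rewrite -val_eqE /= => /negPf ->; rewrite mul0r.
rewrite [X in _ - X]oneE !binE -big_split -mulrA mulr_suml mulr_sumr -sumrB.
apply: eq_bigr => i _; rewrite /mode_coef /=.
rewrite exprNn -signr_odd.
by case: (odd i); rewrite /= ?expr0 ?expr1 ?mul0n ?mul1n; field.
Qed.

Lemma half_gt1 (K : realType) (n : nat) : (3 <= n)%N -> 1 < n%:R / 2 :> K.
Proof. by move=> n_ge3; rewrite ltr_pdivlMr // mul1r ltr_nat. Qed.

(** For even [i > 0] the powers of E agree on both sides and [leq_mul_bin] decides; for [i = 0] the
    concavity inequality is needed too. *)
Lemma mode_coef_cross (K : realType) (dn q p i j : nat) :
  (3 <= dn)%N -> (0 < q)%N -> (q <= p)%N -> (i < j)%N ->
  mode_coef K dn q j * mode_coef K dn p i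
  <= mode_coef K dn q i * mode_coef K dn p j.
Proof.
move=> dn_ge3 q_gt0 le_qp lt_ij.
have j_gt0 : (0 < j)%N by apply: leq_trans lt_ij.
have E_ge1 : 1 <= (dn%:R / 2) ^+ 2 :> K.
  by rewrite exprn_ege1 // ltW ?half_gt1.
rewrite /mode_coef !exprM; set E : K := _ ^+ 2 in E_ge1 *.
have Eq1 := exprn_ege1 q E_ge1; have Ep1 := exprn_ege1 p E_ge1.
rewrite (gtn_eqF j_gt0) !subr0.
have [oj|ej] := boolP (odd j); first by rewrite !mul0n !mulr0 mul0r.
have j_ge2 : (2 <= j)%N by case: j j_gt0 ej {lt_ij} => [|[]].
case: (posnP i) => [->|i_gt0].
  rewrite /= !mul1n !bin0 !mulr1.
  have C := leq_mul_bin_odd le_qp j_ge2.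
  have p_gt0 : 0 < p%:R :> K by rewrite ltr0n (leq_trans q_gt0).
  rewrite -(ler_pM2l p_gt0) -(ler_nat K) !natrM in C *.
  have X := expr_sub1_concave E_ge1 le_qp.
  have EqEp_ge0 : 0 <= E ^+ q * (E ^+ p - 1).
    by rewrite mulr_ge0 ?subr_ge0 // (le_trans ler01).
  (* With C_m = C(2m+1, j), the chain is p E^q (E^p - 1) C_q <= q E^q (E^p - 1) C_p <= p E^p (E^q -
     1) C_p. *)
  have H1 := ler_wpM2l EqEp_ge0 C.
  have H2 := ler_wpM2r (ler0n K 'C(2 * p + 1, j)) X.
  by lra.
rewrite !subr0.
case: (odd i); first by rewrite !mul0n !mulr0 mul0r.
rewrite /= !mul1n mulrACA [leRHS]mulrACA -!natrM ler_wpM2l ?ler_nat //.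
  by rewrite mulr_ge0 // (le_trans ler01).
by apply: leq_mul_bin; lia.
Qed.

Lemma mode_fun_cross (K : realType) (dn q p : nat) (x y : K) :
  (3 <= dn)%N -> (0 < q)%N -> (q <= p)%N -> - (1 / 4) <= x -> x <= y ->
  mode_fun dn q y * mode_fun dn p x <= mode_fun dn q x * mode_fun dn p y.
Proof.
move=> dn_ge3 q_gt0 le_qp x_ge le_xy.
have sq (z : K) : - (1 / 4) <= z -> Num.sqrt (1 + 4 * z) ^+ 2 = 1 + 4 * z.
  by move=> z_ge; rewrite sqr_sqrtr //; lra.
have y_ge := le_trans x_ge le_xy.
have qN : (2 * q + 1 < 2 * p + 2)%N by lia.
have pN : (2 * p + 1 < 2 * p + 2)%N by lia.
rewrite (mode_fun_sum dn qN (sq _ x_ge)) (mode_fun_sum dn qN (sq _ y_ge)).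
rewrite (mode_fun_sum dn pN (sq _ x_ge)) (mode_fun_sum dn pN (sq _ y_ge)).
apply: ler_cross_sum; rewrite ?sqrtr_ge0 ?ler_wsqrtr //; last by lra.
by move=> i j; apply: mode_coef_cross.
Qed.

(** The constant coefficient E^m - 1 is positive and all others are nonnegative. *)
Lemma mode_fun_gt0 (K : realType) (dn m : nat) (g : K) :
  (3 <= dn)%N -> (0 < m)%N -> - (1 / 4) <= g -> 0 < mode_fun dn m g.
Proof.
move=> dn_ge3 m_gt0 g_ge.
have hu : Num.sqrt (1 + 4 * g) ^+ 2 = 1 + 4 * g by rewrite sqr_sqrtr //; lra.
rewrite (mode_fun_sum dn (ltnSn _) hu) big_ord_recl; apply: ltr_pwDl.
  rewrite /mode_coef /= bin0 muln1 expr0 !mulr1 subr_gt0.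
  by rewrite exprn_egt1 ?half_gt1 // muln_eq0 /= -lt0n.
apply: sumr_ge0 => i _; rewrite /mode_coef subr0.
by rewrite !mulr_ge0 ?ler0n ?exprn_ge0 ?sqrtr_ge0 ?mulr_ge0 ?invr_ge0 ?ler0n.
Qed.

Lemma mode_fun0 (K : realType) (dn m : nat) :
  mode_fun dn m 0 = dn%:R ^+ (2 * m) - 1 :> K.
Proof. by rewrite /mode_fun addn1 sseq0 mulr1. Qed.

Lemma mode_funN14 (K : realType) (dn m : nat) :
  mode_fun dn m (- (1 / 4)) = (dn%:R / 2) ^+ (2 * m) - 1 :> K.
Proof.
(* At -1/4 the closed form applies with u = 0. *)
have hu : 0 ^+ 2 = 1 + 4 * - (1 / 4) :> K by rewrite expr0n /=; field.
have := sseq_closed (2 * m + 1) hu; rewrite addr0 subr0 expr1n exprD expr1 => H.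
have D0 : 2 ^+ (2 * m) != 0 :> K by rewrite expf_neq0 // pnatr_eq0.
have -> : mode_fun dn m (- (1 / 4)) = dn%:R ^+ (2 * m)
    * (2 ^+ (2 * m) * 2 * sseq (- (1 / 4)) (2 * m + 1)) / 2 / 2 ^+ (2 * m) - 1 :> K.
  by rewrite /mode_fun; field.
by rewrite H expr_div_n; field.
Qed.

(** * Roots of R *)

Lemma RfunE (K : realType) (p q dn : nat) (beta g : K) :
  Rfun p q beta dn g = beta * mode_fun dn p g - mode_fun dn q g.
Proof. by []. Qed.

Lemma Rfun_ivt (K : realType) (p q dn : nat) (beta a b : K) : a <= b ->
  Rfun p q beta dn a <= 0 -> 0 <= Rfun p q beta dn b ->
  exists g, [/\ a <= g, g <= b & Rfun p q beta dn g = 0].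
Proof.
move=> ab; have [P hP] := sseq_horner K (2 * p + 1).
have [Q hQ] := sseq_horner K (2 * q + 1).
pose T := beta%:P * ((dn%:R ^+ (2 * p))%:P * P - 1)
  - ((dn%:R ^+ (2 * q))%:P * Q - 1).
have TE g : T.[g] = Rfun p q beta dn g by rewrite !hornerE hP hQ.
rewrite -!TE => ha hb.
have [g /andP[ag gb] /rootP] := poly_ivt ab (introT andP (conj ha hb)).
by rewrite TE; exists g.
Qed.

Lemma beta0E (K : realType) (p q dn : nat) :
  beta0 K p q dn = mode_fun dn q 0 / mode_fun dn p 0.
Proof. by rewrite !mode_fun0. Qed.

Lemma betaN14E (K : realType) (p q dn : nat) :
  betaN14 K p q dn = mode_fun dn q (- (1 / 4)) / mode_fun dn p (- (1 / 4)).
Proof. by rewrite !mode_funN14. Qed.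

(** The point is chosen so that [beta * g = beta + 1]. With X = dn^(2q) and s = s_(2q+1)(g), growth
    then gives R >= beta (X s - 1) + 1, and X s >= 1. *)
Lemma Rfun_gt0_large (K : realType) (p q dn : nat) (beta : K) :
  (0 < dn)%N -> (q < p)%N -> 0 < beta -> 0 < Rfun p q beta dn (1 + beta^-1).
Proof.
move=> dn_gt0 lt_qp b_gt0; set g := 1 + _.
have bi_gt0 : 0 < beta^-1 by rewrite invr_gt0.
have g_ge0 : 0 <= g by rewrite addr_ge0 // ltW.
have G := sseq_odd_growth g_ge0 lt_qp.
have s1 := sseq_ge1 (2 * q + 1) g_ge0.
have bg : beta * g = beta + 1 by rewrite /g mulrDr mulr1 divff ?gt_eqF.
have D1 : 1 <= dn%:R :> K by rewrite ler1n.
have Dq : 1 <= dn%:R ^+ (2 * q) :> K by rewrite exprn_ege1.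
have Dqp : dn%:R ^+ (2 * q) <= dn%:R ^+ (2 * p) :> K.
  by rewrite ler_weXn2l // leq_mul2l ltnW.
rewrite /Rfun; set s := sseq g (2 * q + 1) in G s1 *.
set t := sseq _ _ in G *; set X := _ ^+ (2 * q) in Dq Dqp *.
set Y := _ ^+ (2 * p) in Dqp *.
have Xs : 1 <= X * s by rewrite mulr_ege1.
have XY : X * (g * s) <= Y * t.
  by apply: ler_pM; rewrite // ?mulr_ge0 // ?(le_trans ler01).
have := ler_wpM2l (ltW b_gt0) XY.
have -> : beta * (X * (g * s)) = beta * (X * s) + X * s.
  by rewrite mulrCA [beta * (g * s)]mulrA bg; ring.
have := ler_wpM2l (ltW b_gt0) Xs; lra.
Qed.

Theorem theorem3 (K : realType) (p q dn : nat) (beta A B c : K)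
    (q_gt0 : (0 < q)%N) (q_lt_p : (q < p)%N)
    (beta_gt0 : 0 < beta) (dn_ge3 : (3 <= dn)%N)
    (hA : A * (-1) ^+ q = 1) (hB : - B * (-1) ^+ p = beta)
    (hc : c = beta - 1) :
  [/\ beta < beta0 K p q dn ->
        same_signature_collision (Rfun p q beta dn)
        /\ ~ opposite_signature_collision (Rfun p q beta dn),
      beta0 K p q dn < beta -> beta <= betaN14 K p q dn ->
        opposite_signature_collision (Rfun p q beta dn)
    & betaN14 K p q dn < beta ->
        forall g : K, Rfun p q beta dn g = 0 -> g < - (1 / 4)].
Proof.
have p_gt0 := leq_trans (ltn0Sn q) q_lt_p; have le_qp := ltnW q_lt_p.
have N14_le0 : - (1 / 4) <= 0 :> K by lra.
have S0 := mode_fun_gt0 dn_ge3 p_gt0 N14_le0.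
have S14 := mode_fun_gt0 dn_ge3 p_gt0 (lexx (- (1 / 4) : K)).
(* Since S_p is positive at 0 and -1/4, the conditions on [beta] become sign conditions on R
   there. *)
rewrite beta0E betaN14E ltr_pdivlMr // ltr_pdivrMr // ler_pdivlMr //.
rewrite ltr_pdivrMr //; split.
- move=> lt_b; have R0 : Rfun p q beta dn 0 < 0 by rewrite RfunE subr_lt0.
  split.
    have g_ge0 : 0 <= 1 + beta^-1 by rewrite addr_ge0 // invr_ge0 ltW.
    have dn_gt0 : (0 < dn)%N by apply: leq_trans dn_ge3.
    have [g [g0 _ Rg]] := Rfun_ivt g_ge0 (ltW R0)
      (ltW (Rfun_gt0_large dn_gt0 q_lt_p beta_gt0)).
    exists g; split=> //; rewrite lt_def g0 andbT.
    by apply: contra_eq_neq Rg => ->; rewrite lt_eqF.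
  (* At such a root, beta = S_q(g) / S_p(g) would be at least the value of the quotient at 0. *)
  case=> g [g_ge g_lt0 /eqP]; rewrite RfunE subr_eq0 => /eqP Rg.
  have := mode_fun_cross dn_ge3 q_gt0 le_qp g_ge (ltW g_lt0).
  have Sg := mode_fun_gt0 dn_ge3 p_gt0 g_ge.
  rewrite -Rg mulrAC ler_pM2r // => H.
  by have := lt_le_trans lt_b H; rewrite ltxx.
- move=> gt_b le_b.
  have R0 : 0 < Rfun p q beta dn 0 by rewrite RfunE subr_gt0.
  have R14 : Rfun p q beta dn (- (1 / 4)) <= 0 by rewrite RfunE subr_le0.
  have [g [g_ge g_le0 Rg]] := Rfun_ivt N14_le0 R14 (ltW R0).
  (* The root differs from 0 because R(0) > 0; the endpoint -1/4 is allowed. *)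
  exists g; split=> //; rewrite lt_def g_le0 andbT.
  by apply: contra_eq_neq Rg => <-; rewrite gt_eqF.
- move=> gt_b g /eqP; rewrite RfunE subr_eq0 => /eqP Rg.
  rewrite ltNge; apply/negP => g_ge.
  (* At a root g >= -1/4, beta = S_q(g) / S_p(g) is at most the value of the quotient at -1/4. *)
  have := mode_fun_cross dn_ge3 q_gt0 le_qp (lexx _) g_ge.
  have Sg := mode_fun_gt0 dn_ge3 p_gt0 g_ge.
  rewrite -Rg mulrAC ler_pM2r // => H.
  by have := lt_le_trans gt_b H; rewrite ltxx.
Qed.
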